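(* Let $\mathcal{C}$ be a finitely complete category and let $\mathsf{P}(\mathcal{C})$ be the full subcategory of $\mathcal{C}$ determined by the protomodular objects. If $\mathsf{P}(\mathcal{C})$ is closed under finite limits in $\mathcal{C}$, then $\mathsf{P}(\mathcal{C})$ is a protomodular category.
   Context: A pair of morphisms with common codomain $A$ is jointly strongly epimorphic if every monomorphism into $A$ through which both factor is an isomorphism. A point over $B$ is a pair $(f\colon A\to B,\ s\colon B\to A)$ with $fs=1_B$. Given $g\colon C\to B$, form the pullback $C\times_BA$ with projections $\pi_C,\pi_A$; the pullback of $(f,s)$ along $g$ is the point $(\pi_C,\langle 1_C,sg\rangle)$. The point $(f,s)$ is strong if for every $g\colon C\to B$ the pair $(\pi_A,s)$ is jointly strongly epimorphic; it is stably strong if its pullback along every morphism with codomain $B$ is strong. An object $Y$ of $\mathcal{C}$ is protomodular if every point over $Y$ is stably strong. A finitely complete category is protomodular if all points in it are strong. *)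

(* Defs.v *)
From Stdlib Require Import FinFun.

Set Implicit Arguments.
Unset Strict Implicit.
Unset Printing Implicit Defensive.

Record Category : Type := MkCategory {
  ob :> Type;
  hom : ob -> ob -> Type;
  idm : forall A, hom A A;
  comp : forall A B D, hom B D -> hom A B -> hom A D;
  comp_idl : forall A B (f : hom A B), comp (idm B) f = f;
  comp_idr : forall A B (f : hom A B), comp f (idm A) = f;
  comp_assoc : forall A B D E (h : hom D E) (g : hom B D) (f : hom A B),
    comp h (comp g f) = comp (comp h g) f
}.

Arguments hom {c} A B.
Arguments idm {c} A.
Arguments comp {c A B D} g f : rename.

Declare Scope cat_scope.
Delimit Scope cat_scope with cat.
Notation "g ∘ f" := (comp g f) (at level 40, left associativity) : cat_scope.
Open Scope cat_scope.

Record Functor (J C : Category) : Type := MkFunctor {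
  fob :> J -> C;
  fmor : forall i j, hom i j -> hom (fob i) (fob j);
  fmor_id : forall i, fmor (idm i) = idm (fob i);
  fmor_comp : forall i j k (v : hom j k) (u : hom i j),
    fmor (v ∘ u) = fmor v ∘ fmor u
}.

Definition full_subcategory (C : Category) (P : C -> Prop) : Category :=
  {| ob := { A : C | P A };
     hom := fun A B => hom (proj1_sig A) (proj1_sig B);
     idm := fun A => idm (proj1_sig A);
     comp := fun _ _ _ g f => g ∘ f;
     comp_idl := fun _ _ f => comp_idl f;
     comp_idr := fun _ _ f => comp_idr f;
     comp_assoc := fun _ _ _ _ h g f => comp_assoc h g f |}.

(* Finite categories have finitely many objects and finitely many morphisms;
   [Finite T] says that some list contains every element of [T]. *)
Definition finite_category (J : Category) : Prop :=
  Finite J /\ forall i j : J, Finite (hom i j).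

Record Cone (J C : Category) (F : Functor J C) : Type := MkCone {
  apex : C;
  leg : forall j, hom apex (F j);
  leg_natural : forall i j (u : hom i j), fmor F u ∘ leg i = leg j
}.

Record Limit (J C : Category) (F : Functor J C) : Type := MkLimit {
  lim_cone :> Cone F;
  lim_factor : forall c : Cone F, hom (apex c) (apex lim_cone);
  lim_factor_leg : forall (c : Cone F) j,
    leg lim_cone j ∘ lim_factor c = leg c j;
  lim_factor_unique : forall (c : Cone F) (h : hom (apex c) (apex lim_cone)),
    (forall j, leg lim_cone j ∘ h = leg c j) -> h = lim_factor c
}.

Definition finitely_complete (C : Category) : Prop :=
  forall J : Category, finite_category J ->
  forall F : Functor J C, inhabited (Limit F).

(* A diagram in a full subcategory is a diagram all of whose vertices belong to
   it. Every limit in [C] of such a diagram is required to lie in the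
   subcategory, not only a chosen one. *)
Definition closed_under_finite_limits (C : Category) (P : C -> Prop) : Prop :=
  forall J : Category, finite_category J ->
  forall F : Functor J C, (forall j, P (F j)) ->
  forall L : Limit F, P (apex L).

Section Points.
Variable C : Category.

Definition mono (A B : C) (m : hom A B) : Prop :=
  forall (X : C) (u v : hom X A), m ∘ u = m ∘ v -> u = v.

Definition iso (A B : C) (f : hom A B) : Prop :=
  exists g : hom B A, g ∘ f = idm A /\ f ∘ g = idm B.

Definition factors_through (X M A : C) (m : hom M A) (u : hom X A) : Prop :=
  exists u' : hom X M, m ∘ u' = u.

Definition jointly_strongly_epic (X Y A : C) (u : hom X A) (v : hom Y A)
    : Prop :=
  forall (M : C) (m : hom M A),
    mono m -> factors_through m u -> factors_through m v -> iso m.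

Record Pullback (D A B : C) (g : hom D B) (f : hom A B) : Type := MkPullback {
  pb_ob : C;
  pb_fst : hom pb_ob D;
  pb_snd : hom pb_ob A;
  pb_comm : g ∘ pb_fst = f ∘ pb_snd;
  pb_pair : forall (X : C) (u : hom X D) (v : hom X A),
    g ∘ u = f ∘ v -> hom X pb_ob;
  pb_fst_pair : forall X u v (e : g ∘ u = f ∘ v),
    pb_fst ∘ @pb_pair X u v e = u;
  pb_snd_pair : forall X u v (e : g ∘ u = f ∘ v),
    pb_snd ∘ @pb_pair X u v e = v;
  pb_pair_unique : forall X u v (e : g ∘ u = f ∘ v) (h : hom X pb_ob),
    pb_fst ∘ h = u -> pb_snd ∘ h = v -> h = @pb_pair X u v e
}.

Record Point (B : C) : Type := MkPoint {
  pt_ob : C;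
  pt_epi : hom pt_ob B;
  pt_sec : hom B pt_ob;
  pt_split : pt_epi ∘ pt_sec = idm B
}.

Lemma pullback_point_comm (D B : C) (p : Point B) (g : hom D B) :
  g ∘ idm D = pt_epi p ∘ (pt_sec p ∘ g).
Proof. now rewrite comp_idr, comp_assoc, pt_split, comp_idl. Qed.

(* The point [(pi_D, <1_D, s g>)]. *)
Definition pullback_point (D B : C) (p : Point B) (g : hom D B)
    (Q : Pullback g (pt_epi p)) : Point D :=
  {| pt_ob := pb_ob Q;
     pt_epi := pb_fst Q;
     pt_sec := pb_pair Q (pullback_point_comm p g);
     pt_split := pb_fst_pair Q (pullback_point_comm p g) |}.

(* Pullbacks are determined only up to isomorphism; the next two definitions
   quantify over all of them. They are used when [C] is finitely complete, so
   that pullbacks exist. *)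
Definition strong_point (B : C) (p : Point B) : Prop :=
  forall (D : C) (g : hom D B) (Q : Pullback g (pt_epi p)),
    jointly_strongly_epic (pb_snd Q) (pt_sec p).

Definition stably_strong_point (B : C) (p : Point B) : Prop :=
  forall (D : C) (g : hom D B) (Q : Pullback g (pt_epi p)),
    strong_point (pullback_point Q).

Definition protomodular_object (Y : C) : Prop :=
  forall p : Point Y, stably_strong_point p.

End Points.

Definition protomodular_category (C : Category) : Prop :=
  finitely_complete C /\ forall (B : C) (p : Point B), strong_point p.

Definition protomodular_objects (C : Category) : Category :=
  full_subcategory (@protomodular_object C).

(* Main.v *)
(** A point over a protomodular object is strong in [C]: it is its own pullback
    along the identity. Closure under pullbacks makes the inclusion of the
    protomodular objects preserve pullbacks and monomorphisms (via kernel
    pairs), so strongness of the points is inherited by the full subcategory. *)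
Require Import Defs.
From Stdlib Require Import FinFun List.

Set Implicit Arguments.
Unset Strict Implicit.
Unset Printing Implicit Defensive.

Import ListNotations.

Inductive cospan_ob : Set := cs_left | cs_right | cs_base.

(** Each hom-type computes to [unit] or [Empty_set], so the category is thin and all its laws reduce
    to uniqueness of parallel morphisms. *)
Definition cospan_hom (i j : cospan_ob) : Set :=
  match i, j with
  | cs_left, cs_left | cs_right, cs_right | cs_base, cs_base
  | cs_left, cs_base | cs_right, cs_base => unit
  | _, _ => Empty_set
  end.

Lemma cospan_hom_unique (i j : cospan_ob) (u v : cospan_hom i j) : u = v.
Proof. destruct i, j; destruct u, v; reflexivity. Qed.

Definition cospan_id (i : cospan_ob) : cospan_hom i i :=
  match i with cs_left | cs_right | cs_base => tt end.

Definition cospan_comp (i j k : cospan_ob) :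
  cospan_hom j k -> cospan_hom i j -> cospan_hom i k.
Proof. destruct i, j, k; intros v u; solve [exact tt | destruct u | destruct v].
Defined.

Definition cospan : Category :=
  {| ob := cospan_ob;
     hom := cospan_hom;
     idm := cospan_id;
     comp := cospan_comp;
     comp_idl := fun _ _ _ => cospan_hom_unique _ _;
     comp_idr := fun _ _ _ => cospan_hom_unique _ _;
     comp_assoc := fun _ _ _ _ _ _ _ => cospan_hom_unique _ _ |}.

Lemma cospan_finite : finite_category cospan.
Proof.
split.
- exists [cs_left; cs_right; cs_base]; intros []; simpl; tauto.
- intros [] []; simpl;
    solve [exists [tt]; intros []; simpl; tauto | exists []; intros []].
Qed.

Section Pullbacks.
Variables (C : Category) (D A B : C) (g : hom D B) (f : hom A B).

Definition cospan_fob (i : cospan) : C :=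
  match i with cs_left => D | cs_right => A | cs_base => B end.

Definition cospan_fmor (i j : cospan) :
    hom i j -> hom (cospan_fob i) (cospan_fob j) :=
  match i, j return cospan_hom i j -> hom (cospan_fob i) (cospan_fob j) with
  | cs_left, cs_left => fun _ => idm D
  | cs_right, cs_right => fun _ => idm A
  | cs_base, cs_base => fun _ => idm B
  | cs_left, cs_base => fun _ => g
  | cs_right, cs_base => fun _ => f
  | _, _ => fun e => match e with end
  end.

Lemma cospan_fmor_id (i : cospan) : cospan_fmor (idm i) = idm (cospan_fob i).
Proof. destruct i; reflexivity. Qed.

Lemma cospan_fmor_comp (i j k : cospan) (v : hom j k) (u : hom i j) :
  cospan_fmor (v ∘ u) = cospan_fmor v ∘ cospan_fmor u.
Proof.
destruct i, j, k; destruct u, v; simpl;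
  now rewrite ?comp_idl, ?comp_idr.
Qed.

Definition cospan_functor : Functor cospan C :=
  {| fob := cospan_fob;
     fmor := cospan_fmor;
     fmor_id := cospan_fmor_id;
     fmor_comp := cospan_fmor_comp |}.

Definition cospan_cone_leg (X : C) (u : hom X D) (v : hom X A) (j : cospan) :
    hom X (cospan_functor j) :=
  match j with cs_left => u | cs_right => v | cs_base => g ∘ u end.

Lemma cospan_cone_natural (X : C) (u : hom X D) (v : hom X A)
    (e : g ∘ u = f ∘ v) (i j : cospan) (w : hom i j) :
  fmor cospan_functor w ∘ cospan_cone_leg u v i = cospan_cone_leg u v j.
Proof. destruct i, j; destruct w; simpl; now rewrite ?comp_idl. Qed.

Definition cospan_cone (X : C) (u : hom X D) (v : hom X A)
    (e : g ∘ u = f ∘ v) : Cone cospan_functor :=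
  {| leg := cospan_cone_leg u v; leg_natural := cospan_cone_natural e |}.

(** Kept transparent so that [pb_ob] reduces to [apex L], to which closure under limits applies
    directly. *)
Definition pullback_of_limit (L : Limit cospan_functor) : Pullback g f.
Proof.
refine (@MkPullback C D A B g f (apex L)
  (leg L (cs_left : cospan)) (leg L (cs_right : cospan)) _
  (fun X u v e => lim_factor L (cospan_cone e)) _ _ _).
- transitivity (leg L (cs_base : cospan)).
  + exact (leg_natural L (i := cs_left) (j := cs_base) tt).
  + symmetry; exact (leg_natural L (i := cs_right) (j := cs_base) tt).
- intros X u v e; exact (lim_factor_leg L (cospan_cone e) cs_left).
- intros X u v e; exact (lim_factor_leg L (cospan_cone e) cs_right).
- intros X u v e h hu hv.
  apply (lim_factor_unique (c := cospan_cone e));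
    intros []; simpl; try assumption.
  (* Only the leg at the base remains; naturality determines it from the left leg. *)
  rewrite <- (leg_natural L (i := cs_left) (j := cs_base) tt); simpl.
  now rewrite <- comp_assoc, hu.
Defined.

End Pullbacks.

Lemma closed_pullback (C : Category) (P : C -> Prop) (D A B : C)
    (g : hom D B) (f : hom A B) :
  finitely_complete C -> closed_under_finite_limits P ->
  P D -> P A -> P B -> exists Q : Pullback g f, P (pb_ob Q).
Proof.
intros HC HP hD hA hB.
destruct (HC cospan cospan_finite (cospan_functor g f)) as [L].
exists (pullback_of_limit L).
refine (HP cospan cospan_finite (cospan_functor g f) _ L).
intros []; assumption.
Qed.

Section FullSubcategory.
Variables (C : Category) (P : C -> Prop).
Hypothesis C_complete : finitely_complete C.
Hypothesis P_closed : closed_under_finite_limits P.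

Definition forget_functor (J : Category)
    (F : Functor J (full_subcategory P)) : Functor J C :=
  {| fob := fun j => proj1_sig (F j);
     fmor := fun i j u => fmor F u;
     fmor_id := fmor_id F;
     fmor_comp := fun i j k v u => fmor_comp F v u |}.

Definition forget_cone (J : Category) (F : Functor J (full_subcategory P))
    (c : Cone F) : Cone (forget_functor F) :=
  @MkCone J C (forget_functor F) (proj1_sig (apex c)) (leg c)
    (leg_natural c).

(** By fullness, a cone over [F] is a cone in [C] whose apex satisfies [P], so the universal
    property in [C] restricts as soon as the limit apex satisfies [P]. *)
Definition lift_limit (J : Category) (F : Functor J (full_subcategory P))
    (L : Limit (forget_functor F)) (hL : P (apex L)) : Limit F :=
  @MkLimit J (full_subcategory P) F
    (@MkCone J (full_subcategory P) F (exist P (apex L) hL) (leg L)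
       (leg_natural L))
    (fun c => lim_factor L (forget_cone c))
    (fun c => lim_factor_leg L (forget_cone c))
    (fun c => @lim_factor_unique _ _ _ L (forget_cone c)).

Lemma full_subcategory_finitely_complete :
  finitely_complete (full_subcategory P).
Proof.
intros J HJ F.
destruct (C_complete HJ (forget_functor F)) as [L].
constructor; apply (lift_limit (L := L)).
exact (P_closed HJ (F := forget_functor F) (fun j => proj2_sig (F j)) L).
Qed.

(** The test object [X] may lie outside [P], but the kernel pair of [m] formed in [C] lies inside.
    Hence [m] identifies its two projections already in the subcategory, and any [u], [v] with equal
    composites factor through it. *)
Lemma full_subcategory_mono (M A : full_subcategory P) (m : hom M A) :
  mono m -> mono (m : @hom C (proj1_sig M) (proj1_sig A)).
Proof.
intros Hm X u v e.
destruct (closed_pullback (m : @hom C (proj1_sig M) (proj1_sig A))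
  (m : @hom C (proj1_sig M) (proj1_sig A)) C_complete P_closed
  (proj2_sig M) (proj2_sig M) (proj2_sig A)) as [K hK].
assert (E : pb_fst K = pb_snd K)
  by exact (Hm (exist P (pb_ob K) hK) (pb_fst K) (pb_snd K) (pb_comm K)).
rewrite <- (pb_fst_pair K e), E.
exact (pb_snd_pair K e).
Qed.

Definition forget_point (B : full_subcategory P) (p : Point B) :
    Point (proj1_sig B) :=
  @MkPoint C (proj1_sig B) (proj1_sig (pt_ob p)) (pt_epi p) (pt_sec p)
    (pt_split p).

Lemma full_subcategory_strong_point (B : full_subcategory P) (p : Point B) :
  strong_point (forget_point p) -> strong_point p.
Proof.
intros Hp D g Q M m Hm [u Hu] Hs.
(* [Q] is universal only among objects of [P], whereas [Hp] asks for a pullback in [C]. So a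
   pullback [R] is taken in [C]; its object satisfies [P], which gives a comparison [k] from [R] to
   [Q]. *)
destruct (closed_pullback (g : @hom C (proj1_sig D) (proj1_sig B))
  (pt_epi (forget_point p)) C_complete P_closed
  (proj2_sig D) (proj2_sig (pt_ob p)) (proj2_sig B)) as [R hR].
pose (k := pb_pair Q (X := exist P (pb_ob R) hR) (u := pb_fst R)
  (v := pb_snd R) (pb_comm R)).
refine (Hp _ _ R _ m (full_subcategory_mono Hm) _ Hs).
(* The second projection of [R] is that of [Q] after [k], so a factorization of the latter through
   [m] yields one of the former. *)
exists (@comp C _ _ _ u k).
rewrite comp_assoc.
transitivity (@comp C _ _ _ (pb_snd Q) k).
- now rewrite <- Hu.
- exact (pb_snd_pair Q (X := exist P (pb_ob R) hR) (pb_comm R)).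
Qed.

End FullSubcategory.

(** Choosing [A] itself as the pullback, transparently, makes the pulled-back point share its object
    and its split epimorphism with the original by conversion. *)
Definition pullback_along_id (C : Category) (A B : C) (f : hom A B) :
  Pullback (idm B) f.
Proof.
refine (@MkPullback C B A B (idm B) f A f (idm A) _ (fun X u v e => v) _ _ _).
- now rewrite comp_idl, comp_idr.
- intros X u v e; now rewrite <- e, comp_idl.
- intros X u v e; apply comp_idl.
- intros X u v e h _ hv; now rewrite <- hv, comp_idl.
Defined.

Lemma stably_strong_point_strong (C : Category) (B : C) (p : Point B) :
  stably_strong_point p -> strong_point p.
Proof.
intros Hp D g Q M m Hm Hu [s Hs].
refine (Hp B (idm B) (pullback_along_id (pt_epi p)) D g Q M m Hm Hu _).
(* The section of the pulled-back point is [pt_sec p ∘ idm B], equal to [pt_sec p] only up to the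
   unit law. *)
exists s; simpl; now rewrite comp_idr.
Qed.

Theorem corollary7p4 (C : Category)
    (C_fincomplete : finitely_complete C)
    (PC_closed : closed_under_finite_limits (@protomodular_object C)) :
  protomodular_category (protomodular_objects C).
Proof.
split.
- exact (full_subcategory_finitely_complete C_fincomplete PC_closed).
- intros B p.
  apply (full_subcategory_strong_point C_fincomplete PC_closed).
  apply stably_strong_point_strong.
  exact (proj2_sig B (forget_point p)).
Qed.
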